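(* Let $f:\mathbb{C}\to\mathbb{C}$ be a non-constant polynomial such that $f(0)=f'(0)=0$. Then for every complex number $c$ with $|c|>2$, the set $\mathcal{K}_c$ is disconnected.
   Context: The sequence $(f_n)_{n\ge 0}$ is defined by $f_0(z)=z$, $f_1(z)=f(z)$, and $f_n(z)=f_{n-1}(z)f_{n-2}(z)+c$ for $n\ge 2$. The filled-in Julia set is $\mathcal{K}_c=\{z\in\mathbb{C}:\sup_{n\in\mathbb{N}}|f_n(z)|<+\infty\}$. *)

(* Defs.v *)
From HB Require Import structures.
From mathcomp Require Import all_boot all_order all_algebra complex.
From mathcomp Require Import all_classical all_reals all_analysis.

Set Implicit Arguments.
Unset Strict Implicit.
Unset Printing Implicit Defensive.

Import Order.TTheory GRing.Theory Num.Theory numFieldNormedType.Exports.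

Local Open Scope classical_set_scope.
Local Open Scope ring_scope.

(* [R[i]] itself has no topological instances. Packing it as a
   numClosedFieldType gives it the topology of its norm through
   numFieldNormedType. *)
Definition Cplx (R : realType) : numClosedFieldType := R[i]%C.

(* The modulus, with values in [R]; the norm [`|z|] has values in [R[i]]. *)
Definition cmod (R : realType) (z : Cplx R) : R := ComplexField.Normc.normc z.

Fixpoint fseq (R : realType) (f : Cplx R -> Cplx R) (c : Cplx R) (n : nat)
    (z : Cplx R) {struct n} : Cplx R :=
  match n with
  | 0 => z
  | 1 => f z
  | (m.+1 as k).+1 => fseq f c k z * fseq f c m z + c
  end.

Definition filled_julia (R : realType) (f : Cplx R -> Cplx R) (c : Cplx R) :
    set (Cplx R) :=
  [set z | (ereal_sup (range (fun n : nat => (cmod (fseq f c n z))%:E))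
            < +oo)%E].

(* Main.v *)
Require Import Defs.
From HB Require Import structures.
From mathcomp Require Import all_boot all_order all_algebra complex.
From mathcomp Require Import all_classical all_reals all_analysis.
From mathcomp Require Import ring lra separable.
Import Order.TTheory GRing.Theory Num.Theory numFieldNormedType.Exports.
Local Open Scope classical_set_scope.
Local Open Scope ring_scope.

Set Implicit Arguments.
Unset Strict Implicit.
Unset Printing Implicit Defensive.

(* The point 0 is a critical point of every f_n with n >= 1, and it escapes,
   since f_2(0) = f_3(0) = c. The set K_c is the decreasing intersection of the
   compact sets {|f_n| <= |c| or |f_(n+1)| <= |c|}, and the orbits of its points
   are uniformly bounded. Hence, for n large, all the zeros of q = f_n lie in small
   discs centred in K_c on which |q| < |q(0)|. Suppose K_c connected and
   let L = {|q| = |q(0)|}, d = deg q. For a, b in the same connected subset of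
   the complement of L, (z - a) / (z - b) has a continuous d-th root on L: this
   holds for a near b and the relation is transitive. So all the zeros of q can
   be exchanged for a single b in K_c, and q (made monic) has a continuous d-th
   root psi on L. The image of psi is open and compact in a circle, so it is the
   circle. Thus every d-th root of q(0) is a value of psi, and q takes the value
   q(0) at d distinct points: 0 cannot be a critical point of q. *)

(** * The real-valued modulus and the topology it induces *)

Lemma cmodE (R : realType) (z : Cplx R) : `|z| = (cmod z)%:C%C.
Proof. by []. Qed.

Lemma cmod_ge0 (R : realType) (z : Cplx R) : 0 <= cmod z.
Proof. by rewrite -lecR -cmodE; exact: normr_ge0. Qed.

Lemma cmodM (R : realType) (z w : Cplx R) : cmod (z * w) = cmod z * cmod w.
Proof. exact: ComplexField.Normc.normcM. Qed.

Lemma cmodD (R : realType) (z w : Cplx R) : cmod (z + w) <= cmod z + cmod w.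
Proof. exact: le_normcD. Qed.

Lemma cmodN (R : realType) (z : Cplx R) : cmod (- z) = cmod z.
Proof. exact: normcN. Qed.

Lemma cmodV (R : realType) (z : Cplx R) : cmod z^-1 = (cmod z)^-1.
Proof. exact: ComplexField.Normc.normcV. Qed.

Lemma cmod0 (R : realType) : cmod (0 : Cplx R) = 0.
Proof. exact: ComplexField.Normc.normc0. Qed.

Lemma cmod1 (R : realType) : cmod (1 : Cplx R) = 1.
Proof. exact: ComplexField.Normc.normc1. Qed.

Lemma cmod_eq0 (R : realType) (z : Cplx R) : (cmod z == 0) = (z == 0).
Proof.
apply/eqP/eqP => [/ComplexField.Normc.eq0_normc //|->]; exact: cmod0.
Qed.

Lemma cmod_gt0 (R : realType) (z : Cplx R) : (0 < cmod z) = (z != 0).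
Proof. by rewrite lt_def cmod_ge0 cmod_eq0 andbT. Qed.

Lemma cmodX (R : realType) (z : Cplx R) n : cmod (z ^+ n) = cmod z ^+ n.
Proof. by elim: n => [|n IH]; rewrite ?cmod1 // !exprS cmodM IH. Qed.

Lemma cmod_prod (R : realType) (I : Type) (s : seq I) (F : I -> Cplx R) :
  cmod (\prod_(i <- s) F i) = \prod_(i <- s) cmod (F i).
Proof.
elim: s => [|i s IH]; rewrite ?big_nil ?cmod1 // !big_cons cmodM IH //.
Qed.

Lemma cmodBC (R : realType) (z w : Cplx R) : cmod (z - w) = cmod (w - z).
Proof. by rewrite -cmodN opprB. Qed.

Lemma cmod_trans (R : realType) (y x z : Cplx R) :
  cmod (x - z) <= cmod (x - y) + cmod (y - z).
Proof. by rewrite -[x - z](subrKA y); exact: cmodD. Qed.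

Lemma cmodB_ge (R : realType) (z w : Cplx R) : cmod z - cmod w <= cmod (z - w).
Proof. by rewrite lerBlDr -{1}[z](subrK w); exact: cmodD. Qed.

Lemma cmodD_ge (R : realType) (z w : Cplx R) : cmod z - cmod w <= cmod (z + w).
Proof. by rewrite -[w]opprK cmodN; exact: cmodB_ge. Qed.

Lemma cmodC (R : realType) (x : R) : cmod (x%:C%C : Cplx R) = `|x|.
Proof. by rewrite /cmod /= expr0n addr0 sqrtr_sqr. Qed.

(** Balls of the ambient topology have radii in [R[i]]; real radii suffice because a positive
    element of [R[i]] has zero imaginary part. *)
Lemma nbhs_cmodP (R : realType) (z : Cplx R) (A : set (Cplx R)) :
  nbhs z A <-> exists2 e, 0 < e & forall w, cmod (w - z) < e -> A w.
Proof.
split=> [/nbhs_ballP[e /= e0 zA]|[e e0 zA]].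
  move: (e0); rewrite ltcE /= => /andP[/eqP ie re].
  have eE : e = (complex.Re e)%:C%C by case: (e) ie => a b /= ->.
  exists (complex.Re e) => // w wz; apply: zA.
  by rewrite -ball_normE /= distrC cmodE eE ltcR.
apply/nbhs_ballP; exists (e%:C%C) => /=; first by rewrite ltcR.
by move=> w; rewrite -ball_normE /= distrC cmodE ltcR => /zA.
Qed.

Lemma cmod_continuous (R : realType) : continuous (@cmod R).
Proof.
move=> z; apply: (iffRL (@cvgrPdist_lt _ _ _ (nbhs z) _ _ _)) => e e0.
apply/nbhs_cmodP; exists e => // w wz.
have := cmodB_ge z w; have := cmodB_ge w z; rewrite (cmodBC z) => h1 h2.
by rewrite ltr_norml; apply/andP; split; lra.
Qed.

Lemma cmod_near (R : realType) (z : Cplx R) (e : R) :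
  0 < e -> \forall w \near z, cmod (w - z) < e.
Proof. by move=> e0; apply/nbhs_cmodP; exists e. Qed.

Lemma cvg_cmodP (R : realType) (T : Type) (F : set_system T) (FF : Filter F)
    (f : T -> Cplx R) (l : Cplx R) :
  (forall e, 0 < e -> \forall x \near F, cmod (f x - l) < e) -> f @ F --> l.
Proof. by move=> H A /nbhs_cmodP[e e0 lA]; apply: filterS (H _ e0) => x; exact: lA. Qed.

Lemma horner_continuous (R : realType) (p : {poly Cplx R}) : continuous (horner p).
Proof.
elim/poly_ind: p => [|p a IH] z.
  by have -> : horner (0 : {poly Cplx R}) = cst 0;
    [apply/funext => w; rewrite horner0 | exact: cst_continuous].
have -> : horner (p * 'X + a%:P) = fun w => p.[w] * w + a.
  by apply/funext => w; rewrite !hornerE.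
rewrite /continuous_at.
apply: (@cvgD _ _ _ (nbhs z) _ (fun w => p.[w] * w) (cst a)); last exact: cvg_cst.
by apply: (@cvgM _ _ (nbhs z) _ (horner p) id); [exact: IH | exact: cvg_id].
Qed.

Lemma horner_cmod_continuous (R : realType) (p : {poly Cplx R}) :
  continuous (fun z => cmod p.[z]).
Proof.
move=> z; apply: (@continuous_comp _ _ _ (horner p) (@cmod R)).
  exact: horner_continuous.
exact: cmod_continuous.
Qed.

Lemma cvec_continuous (R : realType) (a b : Cplx R) :
  continuous (fun t : R => a + t%:C%C * b : Cplx R).
Proof.
move=> t; apply: cvg_cmodP => e e0.
have b0 : 0 < cmod b + 1 by rewrite ltr_wpDl ?cmod_ge0.
near=> s.
have -> : a + s%:C%C * b - (a + t%:C%C * b) = (s - t)%:C%C * b.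
  by rewrite rmorphB /=; ring.
have st : `|s - t| < e / (cmod b + 1).
  near: s; apply/nbhs_ballP; exists (e / (cmod b + 1)); first exact: divr_gt0.
  by move=> s; rewrite /ball /= distrC.
rewrite cmodM cmodC; rewrite ltr_pdivlMr // in st.
apply: le_lt_trans st; apply: ler_wpM2l => //; lra.
Unshelve. all: by end_near. Qed.

(** Heine-Borel: [A] is a closed subset of the image of the compact square of side [2 * B] under
    [(a, b) -> a + i b]. *)
Lemma compact_closed_bounded (R : realType) (A : set (Cplx R)) (B : R) :
  closed A -> (forall z, A z -> cmod z <= B) -> compact A.
Proof.
move=> cA bA.
pose f (u : R * R) : Cplx R := Complex u.1 u.2.
have fc : continuous f.
  move=> u; have -> : f = fun u => (0 + (u.1)%:C%C * 1) + (0 + (u.2)%:C%C * 'i%C).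
    by apply/funext => v; rewrite /f; simpc.
  apply: cvgD; apply: (@cvg_comp _ _ _ _ (fun t : R => 0 + t%:C%C * _ : Cplx R));
    do ?[exact: cvg_fst | exact: cvg_snd | exact: cvec_continuous].
have cS : compact (f @` (`[- B, B]%classic `*` `[- B, B]%classic)).
  apply: continuous_compact; first exact: continuous_subspaceT.
  by apply: compact_setX; exact: segment_compact.
apply: (subclosed_compact cA cS) => -[a b] Az; exists (a, b) => //=.
have := bA _ Az; rewrite /cmod /= => h.
have [ha hb] : `|a| <= B /\ `|b| <= B.
  by rewrite -!sqrtr_sqr; split; apply: le_trans h; rewrite ler_wsqrtr// ?lerDl ?lerDr sqr_ge0.
by split; rewrite /= in_itv /= -ler_norml.
Qed.

(** * Polynomials as open and proper maps *)

Lemma prod_small_factor (R : realType) (s : seq (Cplx R)) (z : Cplx R) (e : R) :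
  0 < e -> \prod_(r <- s) cmod (z - r) < e ^+ size s ->
  exists2 r, r \in s & cmod (r - z) < e.
Proof.
move=> e0; elim: s => [|r s IH]; first by rewrite big_nil expr0 ltxx.
rewrite big_cons /= exprS => h.
have [rz|zr] := ltP (cmod (r - z)) e; first by exists r; rewrite ?mem_head.
have [] := IH _; last by move=> r' r's ?; exists r'; rewrite // inE r's orbT.
rewrite -(ltr_pM2l e0); apply: le_lt_trans h; rewrite cmodBC in zr.
by apply: ler_wpM2r => //; rewrite -cmod_prod cmod_ge0.
Qed.

Lemma cmod_horner_prod (R : realType) (a : Cplx R) (s : seq (Cplx R)) (z : Cplx R) :
  cmod (a *: \prod_(r <- s) ('X - r%:P)).[z] =
  cmod a * \prod_(r <- s) cmod (z - r).
Proof.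
rewrite hornerZ cmodM horner_prod cmod_prod; congr (_ * _).
by apply: eq_bigr => r _; rewrite !hornerE.
Qed.

(** Factor [p - v] into linear factors: a small value at [z] makes one factor small, so a root lies
    near [z]. This is the open mapping theorem with an explicit radius, independent of [z]. *)
Lemma horner_small_root (R : realType) (p : {poly Cplx R}) (v z : Cplx R) (e : R) :
  (1 < size p)%N -> 0 < e ->
  cmod (p.[z] - v) < cmod (lead_coef p) * e ^+ (size p).-1 ->
  exists2 w, cmod (w - z) < e & p.[w] = v.
Proof.
move=> p1 e0.
have vp : (size (- v%:P) < size p)%N.
  by rewrite size_polyN (leq_ltn_trans (size_polyC_leq1 _)).
have lcE : lead_coef (p - v%:P) = lead_coef p by rewrite lead_coefDl.
have l0 : lead_coef p != 0 by rewrite lead_coef_eq0 -size_poly_gt0 ltnW.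
have [s sE] := closed_field_poly_normal (p - v%:P); rewrite lcE in sE.
have sz : (size p).-1 = size s.
  have := congr1 (fun q : {poly Cplx R} => size q) sE.
  by rewrite size_polyDl // size_scale // size_prod_XsubC => ->.
have hE w : p.[w] - v = (p - v%:P).[w] by rewrite !hornerE.
rewrite hE sE cmod_horner_prod ltr_pM2l ?cmod_gt0 // sz => /(prod_small_factor e0).
case=> r rs rz; exists r => //; apply/eqP; rewrite -subr_eq0 hE sE hornerZ mulf_eq0.
by apply/orP; right; move: rs; rewrite -root_prod_XsubC.
Qed.

Lemma horner_open (R : realType) (p : {poly Cplx R}) (z : Cplx R) (e : R) :
  (1 < size p)%N -> 0 < e ->
  exists2 d, 0 < d & forall v, cmod (v - p.[z]) < d ->
    exists2 w, cmod (w - z) < e & p.[w] = v.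
Proof.
move=> p1 e0; exists (cmod (lead_coef p) * e ^+ (size p).-1) => [|v].
  by rewrite mulr_gt0 ?exprn_gt0 // cmod_gt0 lead_coef_eq0 -size_poly_gt0 ltnW.
by rewrite cmodBC => /(horner_small_root p1 e0).
Qed.

Lemma horner_preim_bounded (R : realType) (p : {poly Cplx R}) (m : R) :
  (1 < size p)%N -> exists B, forall z, cmod p.[z] <= m -> cmod z <= B.
Proof.
move=> p1.
have l0 : 0 < cmod (lead_coef p).
  by rewrite cmod_gt0 lead_coef_eq0 -size_poly_gt0 ltnW.
have [s sE] := closed_field_poly_normal p.
have sz : (size p).-1 = size s.
  have := congr1 (fun q : {poly Cplx R} => size q) sE.
  by rewrite size_scale -?cmod_gt0 // size_prod_XsubC => ->.
(* The summand [|m| / |lead_coef p|] absorbs [m], and [1 <= t] gives [t <= t ^+ size s], so some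
   root lies within [t] of [z]. *)
pose t := 1 + `|m| / cmod (lead_coef p).
have t1 : 1 <= t by rewrite lerDl divr_ge0 ?cmod_ge0.
exists (t + \sum_(r <- s) cmod r) => z; rewrite {1}sE cmod_horner_prod => h.
have [] := @prod_small_factor R s z t; first lra.
  rewrite -(ltr_pM2l l0); apply: le_lt_trans h _.
  apply: (@lt_le_trans _ _ (cmod (lead_coef p) * t)).
    rewrite /t mulrDr mulr1 mulrCA divff ?gt_eqF// mulr1.
    by have := ler_norm m; lra.
  rewrite ler_pM2l //; apply: ler_eXnr => //.
  by rewrite -sz -ltnS prednK // ltnW.
move=> r rs rz; have := cmodB_ge z r; rewrite (cmodBC z) => h2.
suff : cmod r <= \sum_(r <- s) cmod r by lra.
rewrite (big_rem r rs) /= lerDl; apply: sumr_ge0 => *; exact: cmod_ge0.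
Qed.

Lemma horner_disk_bounded (R : realType) (p : {poly Cplx R}) (B : R) :
  exists M, forall z, cmod z <= B -> cmod p.[z] <= M.
Proof.
elim/poly_ind: p => [|p a [M IH]].
  by exists 0 => z _; rewrite horner0 cmod0.
exists (M * B + cmod a) => z zB; rewrite !hornerE.
apply: le_trans (cmodD _ _) _; rewrite lerD2r cmodM.
by apply: ler_pM; rewrite ?cmod_ge0 ?IH.
Qed.

(** * The [d]-th power near 1 and a local branch of its inverse *)

(** The constants compose: [|y| <= 2 ^+ b] as [s <= 1], and
    [(2^a - 1) 2^b + (2^b - 1) = 2^(a+b) - 1]. *)
Lemma cmodM_near1 (R : realType) (x y : Cplx R) (a b : nat) (s : R) :
  0 <= s <= 1 -> cmod (x - 1) <= (2 ^+ a - 1) * s ->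
  cmod (y - 1) <= (2 ^+ b - 1) * s -> cmod (x * y - 1) <= (2 ^+ (a + b) - 1) * s.
Proof.
move=> /andP[s0 s1] hx hy.
have -> : x * y - 1 = (x - 1) * y + (y - 1) by ring.
apply: le_trans (cmodD _ _) _; rewrite cmodM.
have a1 : 1 <= 2 ^+ a :> R by apply: exprn_ege1; lra.
have b1 : 1 <= 2 ^+ b :> R by apply: exprn_ege1; lra.
have yb : cmod y <= 2 ^+ b.
  have := cmodB_ge y 1; rewrite cmod1.
  have : (2 ^+ b - 1) * s <= (2 ^+ b - 1) * 1 by apply: ler_wpM2l; lra.
  lra.
have := ler_pM (cmod_ge0 _) (cmod_ge0 _) hx yb.
rewrite exprD; set A := 2 ^+ a in a1 hx *; set D := 2 ^+ b in b1 yb hy *.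
move=> h; apply: le_trans (lerD h hy) _; rewrite le_eqVlt.
by apply/orP; left; apply/eqP; ring.
Qed.

Lemma cmodX_near1 (R : realType) (x : Cplx R) (k : nat) (s : R) :
  0 <= s <= 1 -> cmod (x - 1) <= s -> cmod (x ^+ k - 1) <= (2 ^+ k - 1) * s.
Proof.
move=> s1 hx; elim: k => [|k IH]; first by rewrite !expr0 !subrr mul0r cmod0.
rewrite exprS; apply: (@cmodM_near1 R x (x ^+ k) 1 k s) => //.
by rewrite expr1; lra.
Qed.

(** In [x^d - y^d = (x - y) S], the factor [S] is a sum of [d] monomials within 1/2 of 1, so
    [|S| >= d / 2]. In particular the power map is injective near 1. *)
Lemma expX_expand_near1 (R : realType) (d : nat) : (0 < d)%N ->
  exists2 s : R, 0 < s & forall x y : Cplx R, cmod (x - 1) <= s -> cmod (y - 1) <= s ->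
    cmod (x - y) <= 2 * cmod (x ^+ d - y ^+ d).
Proof.
case: d => // d _; have p2 n : 0 < 2 ^+ n :> R by apply: exprn_gt0; lra.
have p1 n : 1 <= 2 ^+ n :> R by apply: exprn_ege1; lra.
(* The exponent is now [d.+1] and the monomials of [S] have degree [d], so they differ from 1 by at
   most [(2^d - 1) / 2^(d+1) <= 1/2]. *)
exists (2 ^+ d.+1)^-1; first by rewrite invr_gt0.
set s := (2 ^+ d.+1)^-1.
have s01 : 0 <= s <= 1 by rewrite invr_ge0 ltW //= invf_le1.
move=> x y hx hy; rewrite subrXX cmodM /=.
set S := \sum_(_ < _) _.
suff hS : 1 <= 2 * cmod S by have := ler_wpM2l (cmod_ge0 (x - y)) hS; lra.
have hd (i : 'I_d.+1) : cmod (x ^+ (d - i) * y ^+ i - 1) <= 2^-1.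
  have := cmodM_near1 s01 (cmodX_near1 (d - i) s01 hx) (cmodX_near1 i s01 hy).
  rewrite subnK -1?ltnS // => h; apply: le_trans h _.
  rewrite /s exprS invfM; have := mulfV (lt0r_neq0 (p2 d)); set t := _^-1.
  have : 0 <= t by rewrite invr_ge0 ltW.
  lra.
have hSd : cmod (S - d.+1%:R) <= d.+1%:R / 2.
  have -> : S - d.+1%:R = \sum_(i < d.+1) (x ^+ (d - i) * y ^+ i - 1).
    by rewrite sumrB sumr_const card_ord.
  rewrite mulr_natl -[in leRHS](card_ord d.+1) -sumr_const.
  elim/big_ind2 : _ => [|a b u v ha hb|i _]; last exact: hd.
    by rewrite cmod0.
  by apply: le_trans (cmodD _ _) _; exact: lerD.
have dR : (d.+1%:R : Cplx R) = (d.+1%:R)%:C%C by rewrite rmorph_nat.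
have := cmodB_ge (d.+1%:R : Cplx R) S; rewrite cmodBC {1}dR cmodC ger0_norm ?ler0n//.
have : 1 <= d.+1%:R :> R by rewrite ler1n.
lra.
Qed.

(** Openness of ['X^d] at 1 provides a root near 1; the expansion estimate makes any such choice
    Lipschitz, so no logarithm is required. *)
Lemma root_section_near1 (R : realType) (d : nat) : (0 < d)%N ->
  exists t : R, exists2 f : Cplx R -> Cplx R, 0 < t &
    forall u, cmod (u - 1) < t -> f u ^+ d = u /\
      forall v, cmod (v - 1) < t -> cmod (f u - f v) <= 2 * cmod (u - v).
Proof.
move=> d0; have [s s0 hs] := @expX_expand_near1 R d d0.
have [|t t0 ht] := @horner_open R 'X^d 1 s _ s0; first by rewrite size_polyXn.
have /choice[f hf] : forall u : Cplx R, exists w,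
    cmod (u - 1) < t -> cmod (w - 1) < s /\ w ^+ d = u.
  move=> u; have [ut|tu] := ltP (cmod (u - 1)) t; last by exists 0.
  have [|w ws wu] := ht u; first by rewrite hornerXn expr1n.
  by exists w => _; split => //; rewrite -wu hornerXn.
exists t, f => // u ut; have [fs fu] := hf u ut; split => // v vt.
have [gs gv] := hf v vt; rewrite -{2}fu -{2}gv.
by apply: hs; exact: ltW.
Qed.

(** * Continuous [d]-th roots of [(z - a) / (z - b)] on a closed set *)

Definition continuous_on (R : realType) (L : set (Cplx R)) (g : Cplx R -> Cplx R) :=
  forall z, L z -> g x @[x --> within L (nbhs z)] --> g z.

Lemma continuous_on_cmodP (R : realType) (L : set (Cplx R)) (g : Cplx R -> Cplx R) :
  continuous_on L g <-> forall z e, L z -> 0 < e ->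
    exists2 d, 0 < d & forall w, L w -> cmod (w - z) < d -> cmod (g w - g z) < e.
Proof.
split=> [gc z e Lz e0|H z Lz].
  have := gc z Lz _ (cmod_near (g z) e0).
  move/nbhs_cmodP => [d d0 hd]; exists d => // w Lw wz; exact: hd.
apply: cvg_cmodP => e e0; have [d d0 hd] := H z e Lz e0.
by apply/nbhs_cmodP; exists d => // w wz Lw; exact: hd.
Qed.

Lemma continuous_onM (R : realType) (L : set (Cplx R)) (f g : Cplx R -> Cplx R) :
  continuous_on L f -> continuous_on L g -> continuous_on L (fun z => f z * g z).
Proof.
by move=> fc gc z Lz; apply: (@cvgM _ _ (within L (nbhs z)) _ f g); [exact: fc|exact: gc].
Qed.

Lemma continuous_on_prod (R : realType) (I : Type) (L : set (Cplx R)) (s : seq I)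
    (f : I -> Cplx R -> Cplx R) :
  (forall i, continuous_on L (f i)) ->
  continuous_on L (fun z => \prod_(i <- s) f i z).
Proof.
move=> fc; elim: s => [|i s IH].
  have -> : (fun z => \prod_(i <- [::]) f i z) = cst 1 by apply/funext => z; rewrite big_nil.
  by move=> z _; exact: cvg_cst.
have -> : (fun z => \prod_(j <- i :: s) f j z) = fun z => f i z * \prod_(j <- s) f j z.
  by apply/funext => z; rewrite big_cons.
exact (@continuous_onM R L (f i) (fun z => \prod_(j <- s) f j z) (fc i) IH).
Qed.

Lemma continuous_on_subC (R : realType) (L : set (Cplx R)) (a : Cplx R) :
  continuous_on L (fun z => z - a).
Proof.
apply/continuous_on_cmodP => z e _ e0; exists e => // w _ wz.
by rewrite (_ : _ - _ = w - z) //; ring.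
Qed.

(** A substitute for winding numbers: for [a], [b] off [L], such a root forces every loop in [L] to
    wind around [a] and [b] equally often modulo [d]. *)
Definition ratio_root (R : realType) (d : nat) (L : set (Cplx R)) (a b : Cplx R) :=
  exists2 g : Cplx R -> Cplx R, continuous_on L g &
    forall z, L z -> g z ^+ d = (z - a) / (z - b).

Lemma ratio_root_refl (R : realType) (d : nat) (L : set (Cplx R)) (a : Cplx R) :
  ~ L a -> ratio_root d L a a.
Proof.
move=> La; exists (cst 1) => [z _|z Lz]; first exact: cvg_cst.
rewrite expr1n divff // subr_eq0; by apply: contra_notN La => /eqP <-.
Qed.

Lemma ratio_root_trans (R : realType) (d : nat) (L : set (Cplx R)) (b a c : Cplx R) :
  ~ L b -> ratio_root d L a b -> ratio_root d L b c -> ratio_root d L a c.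
Proof.
move=> Lb [f fc hf] [g gc hg]; exists (fun z => f z * g z); first exact (continuous_onM fc gc).
move=> z Lz; rewrite exprMn hf // hg // mulrA divfK // subr_eq0.
by apply: contra_notN Lb => /eqP <-.
Qed.

(* [(z - a) / (z - b)] is uniformly close to [1] for [a] close to [b], so the
   branch of the root near [1] can be used. *)
Lemma ratio_root_near (R : realType) (d : nat) (L : set (Cplx R)) (e : R) :
  (0 < d)%N -> 0 < e ->
  exists2 t, 0 < t & forall a b, cmod (a - b) < t ->
    (forall z, L z -> e <= cmod (z - b)) -> ratio_root d L a b.
Proof.
move=> d0 e0; have [t [f t0 hf]] := @root_section_near1 R d d0.
exists (t * e) => [|a b ab eb]; first exact: mulr_gt0.
have nz z : L z -> z - b != 0 by move=> /eb; rewrite -cmod_gt0; lra.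
pose u z := (z - a) / (z - b).
have u1 z : L z -> cmod (u z - 1) < t.
  move=> Lz; have -> : u z - 1 = (b - a) / (z - b).
    by rewrite /u; field; exact: nz.
  rewrite cmodM cmodV ltr_pdivrMr ?cmod_gt0 ?nz // (cmodBC b).
  by apply: lt_le_trans ab _; rewrite ler_pM2l // eb.
have uc : continuous_on L u.
  move=> z Lz; apply: (@cvgM _ _ (within L (nbhs z)) _ (fun z => z - a) (fun z => (z - b)^-1)).
    exact: continuous_on_subC.
  apply: (@cvgV _ _ (within L (nbhs z)) _ (fun z => z - b)); first exact: nz.
  exact: continuous_on_subC.
exists (f \o u) => [|z Lz]; last by have [] := hf _ (u1 z Lz).
apply/continuous_on_cmodP => z x Lz x0.
have [|r r0 hr] := (iffLR (continuous_on_cmodP L u)) uc z (x / 2) Lz; first lra.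
exists r => // w Lw wz; have [_ /(_ _ (u1 z Lz))] := hf _ (u1 w Lw).
have := hr w Lw wz; rewrite /=; lra.
Qed.

Lemma closed_dist_gt0 (R : realType) (L : set (Cplx R)) (b : Cplx R) :
  closed L -> ~ L b -> exists2 e, 0 < e & forall z, L z -> e <= cmod (z - b).
Proof.
move=> Lc Lb; have /nbhs_cmodP[e e0 he] : nbhs b (~` L).
  by apply: open_nbhs_nbhs; split => //; exact: closed_openC.
by exists e => // z Lz; rewrite leNgt; apply/negP => /he.
Qed.

(** Off [L], both being related to [b] and not being related to [b] are open conditions, so the
    points of [S] related to [b] form a nonempty clopen part of [S]. *)
Lemma ratio_root_connected (R : realType) (d : nat) (L S : set (Cplx R)) (a b : Cplx R) :
  (0 < d)%N -> closed L -> connected S -> S `&` L = set0 -> S a -> S b ->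
  ratio_root d L a b.
Proof.
move=> d0 Lc Sc SL Sa Sb.
pose V := [set x | ~ L x /\ ratio_root d L x b].
pose W := [set x | ~ L x /\ ~ ratio_root d L x b].
(* Points [y] within [e / 2] of [x] stay at distance at least [e / 2] from [L], so the local lemma
   applies with either point as denominator. *)
have key x : ~ L x -> \forall y \near x, ~ L y /\ ratio_root d L x y /\ ratio_root d L y x.
  move=> Lx; have [e e0 he] := closed_dist_gt0 Lc Lx.
  have [|t t0 ht] := @ratio_root_near R d L (e / 2) d0; first lra.
  apply/nbhs_cmodP; exists (Order.min t (e / 2)); first by rewrite lt_min t0; lra.
  move=> y; rewrite lt_min => /andP[yt ye].
  have hy z : L z -> e / 2 <= cmod (z - y).
    by move=> /he h; have := cmod_trans y z x; lra.
  split; first by move=> /hy; rewrite subrr cmod0; lra.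
  by split; apply: ht => //; [rewrite cmodBC | move=> z /he; lra].
have Vo : open V.
  rewrite openE => x [Lx Px]; near=> y.
  have [Ly [_ yx]] : ~ L y /\ ratio_root d L x y /\ ratio_root d L y x by near: y; exact: key.
  by split => //; exact: ratio_root_trans Lx yx Px.
have Wo : open W.
  rewrite openE => x [Lx Px]; near=> y.
  have [Ly [xy _]] : ~ L y /\ ratio_root d L x y /\ ratio_root d L y x by near: y; exact: key.
  by split => // Py; apply: Px; exact: ratio_root_trans Ly xy Py.
have SnL x : S x -> ~ L x by move=> Sx Lx; rewrite -[False]/(set0 x) -SL.
suff : S `&` V = S by move=> SV; move: Sa; rewrite -SV => -[_ []].
apply: Sc.
- by exists b; split => //; split; [exact: SnL | apply: ratio_root_refl; exact: SnL].
- by exists V.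
- exists (~` W); first exact: open_closedC.
  apply/seteqP; split => x [Sx]; first by move=> [_ Px]; split => // -[].
  move=> Wx; split => //; split; first exact: SnL.
  by apply: contrapT => Px; apply: Wx; split => //; exact: SnL.
Unshelve. all: by end_near. Qed.

(** The segment from [b] to [a] is connected and stays in the disc, hence off [L]. *)
Lemma ratio_root_ball (R : realType) (d : nat) (L : set (Cplx R)) (a b : Cplx R) (e : R) :
  (0 < d)%N -> closed L -> (forall z, cmod (z - b) < e -> ~ L z) ->
  cmod (a - b) < e -> ratio_root d L a b.
Proof.
move=> d0 Lc bL ab; pose h (t : R) : Cplx R := b + t%:C%C * (a - b).
apply: (@ratio_root_connected R d L (h @` `[0, 1]%classic)) => //.
- apply: connected_continuous_connected; first exact: segment_connected.
  by apply: continuous_subspaceT; exact: cvec_continuous.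
- apply/seteqP; split => // _ [[t /= + <-]]; rewrite in_itv /= => /andP[t0 t1].
  apply: bL; rewrite /h addrC addKr cmodM cmodC ger0_norm //.
  by apply: le_lt_trans ab; rewrite -[leRHS]mul1r ler_wpM2r ?cmod_ge0.
- by exists 1; rewrite /= ?in_itv /= ?lexx ?ler01 // /h mul1r addrC subrK.
- by exists 0; rewrite /= ?in_itv /= ?lexx ?ler01 // /h mul0r addr0.
Qed.

(** * Moving along a circle *)

Lemma sqr_cmod (R : realType) (a b : R) : cmod (Complex a b : Cplx R) ^+ 2 = a ^+ 2 + b ^+ 2.
Proof. by rewrite /cmod /= sqr_sqrtr // addr_ge0 ?sqr_ge0. Qed.

(** Rotate [x] by a small angle in the direction of [y]. The rational parametrisation of rotations
    keeps the computation algebraic. *)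
Lemma circle_step (R : realType) (x y : Cplx R) (e : R) :
  cmod x = cmod y -> x != y -> 0 < e ->
  exists w, [/\ cmod w = cmod x, cmod (w - x) < e & cmod (w - y) < cmod (x - y)].
Proof.
case: x => a b; case: y => p q xy nxy e0.
have xy2 : a ^+ 2 + b ^+ 2 = p ^+ 2 + q ^+ 2 by rewrite -!sqr_cmod xy.
(* [h] and [k] are the real and imaginary parts of the product of [y] by the conjugate of [x]. *)
pose k := a * q - b * p; pose h := a * p + b * q.
set r := cmod (Complex a b : Cplx R) in xy *.
have r0 : 0 <= r by exact: cmod_ge0.
have rE : r ^+ 2 = a ^+ 2 + b ^+ 2 by rewrite -sqr_cmod.
(* The rotation of parameter [s] lowers the squared distance to [y] by [4 s (k - s h) / (1 + s^2)].
   For [k != 0], take [s] with the sign of [k] and [|s| < |k| / (|h| + 1)]. *)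
have [s se sk] : exists2 s : R, 2 * `|s| * r < e & 0 < s * (k - s * h).
  pose m := if k == 0 then 1 else `|k| / (`|h| + 1).
  have h1 : 0 < `|h| + 1 by rewrite ltr_wpDl.
  have m0 : 0 < m by rewrite /m; case: eqVneq => // k0; rewrite divr_gt0 ?normr_gt0.
  pose t := Order.min m (e / (2 * r + 1)) / 2.
  have t0 : 0 < t by rewrite divr_gt0 // lt_min m0 divr_gt0 //; lra.
  have tm : t < m.
    have := ge_min m m (e / (2 * r + 1)).
    by rewrite lexx /= /t; move: t0; rewrite /t; lra.
  have te : t < e / (2 * r + 1).
    have := ge_min (e / (2 * r + 1)) m (e / (2 * r + 1)).
    by rewrite lexx orbT /t; move: t0; rewrite /t; lra.
  have te' : 2 * t * r < e.
    by move: te; rewrite ltr_pdivlMr; lra.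
  have [kp|kn|k0] := ltgtP 0 k.
  - exists t; first by rewrite gtr0_norm.
    rewrite pmulr_rgt0 // subr_gt0; move: tm.
    rewrite /m gt_eqF // gtr0_norm // ltr_pdivlMr // => tm.
    have : t * h <= t * `|h| by rewrite ler_pM2l // ler_norm.
    lra.
  - exists (- t); first by rewrite normrN gtr0_norm.
    rewrite mulNr -mulrN pmulr_rgt0 //; move: tm.
    rewrite /m lt_eqF // ltr0_norm // ltr_pdivlMr // => tm.
    have : t * h <= t * `|h| by rewrite ler_pM2l // ler_norm.
    lra.
  (* If [k = 0] then [y = - x] or [x = 0], once [x = y] is excluded; it suffices that [h < 0].
     Otherwise [h^2 + k^2 = |x|^2 |y|^2 = |x|^4] gives [h = |x|^2], hence [x = y]. *)
  - exists t; first by rewrite gtr0_norm.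
    rewrite -k0 sub0r pmulr_rgt0 // -mulrN pmulr_rgt0 // oppr_gt0 ltNge; apply/negP => hp.
    have : h = a ^+ 2 + b ^+ 2.
      apply/eqP; rewrite -(eqrXn2 (n := 2)) // ?addr_ge0 ?sqr_ge0 //; apply/eqP.
      have : k ^+ 2 = 0 by rewrite -k0 expr0n.
      have -> : (a ^+ 2 + b ^+ 2) ^+ 2 = (a ^+ 2 + b ^+ 2) * (p ^+ 2 + q ^+ 2) by rewrite -xy2.
      rewrite /k /h => kk; rewrite -[LHS]addr0 -kk; ring.
    move=> hE; have s0 : (a - p) ^+ 2 + (b - q) ^+ 2 = 0.
      have -> : (a - p) ^+ 2 + (b - q) ^+ 2 =
          (a ^+ 2 + b ^+ 2) + (p ^+ 2 + q ^+ 2) - 2 * h by rewrite /h; ring.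
      by rewrite -xy2 hE; ring.
    move/eqP: s0; rewrite paddr_eq0 ?sqr_ge0 // !sqrf_eq0 !subr_eq0 => /andP[/eqP ap /eqP bq].
    by move: nxy; rewrite ap bq eqxx.
pose N := 1 + s ^+ 2.
have N0 : 0 < N by rewrite /N; have := sqr_ge0 s; lra.
have N0' := lt0r_neq0 N0.
(* This is [x (1 + i s) / (1 - i s)]. *)
exists (Complex ((a * (1 - s ^+ 2) - 2 * s * b) / N) ((b * (1 - s ^+ 2) + 2 * s * a) / N)).
have sq (u v : R) : 0 <= u -> 0 <= v -> u ^+ 2 = v ^+ 2 -> u = v.
  by move=> u0 v0 /eqP; rewrite eqrXn2 // => /eqP.
split.
- apply: sq; rewrite ?cmod_ge0 // sqr_cmod rE /N; field; exact: N0'.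
- rewrite -(ltr_pXn2r (n := 2)) ?nnegrE ?cmod_ge0 ?ltW //.
  have : (2 * `|s| * r) ^+ 2 < e ^+ 2 by rewrite ltr_pXn2r ?nnegrE ?mulr_ge0 // ltW.
  apply: le_lt_trans; rewrite -[X in cmod X ^+ 2]/(Complex (_ - a) (_ - b)) sqr_cmod.
  rewrite !exprMn real_normK ?num_real // rE.
  have -> : ((a * (1 - s ^+ 2) - 2 * s * b) / N - a) ^+ 2 +
      ((b * (1 - s ^+ 2) + 2 * s * a) / N - b) ^+ 2
     = (2 ^+ 2 * s ^+ 2 * (a ^+ 2 + b ^+ 2)) / N by rewrite /N; field; exact: N0'.
  rewrite ler_pdivrMr // ler_peMr //; last by rewrite /N lerDl sqr_ge0.
  by rewrite -rE -!exprMn sqr_ge0.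
- rewrite -(ltr_pXn2r (n := 2)) ?nnegrE ?cmod_ge0 //.
  rewrite -[X in cmod X ^+ 2 < _]/(Complex (_ - p) (_ - q)) sqr_cmod.
  rewrite -[X in _ < cmod X ^+ 2]/(Complex (a - p) (b - q)) sqr_cmod -subr_gt0.
  have := divr_gt0 sk N0; set g := _ / N => g0.
  suff -> : (a - p) ^+ 2 + (b - q) ^+ 2 - (((a * (1 - s ^+ 2) - 2 * s * b) / N - p) ^+ 2 +
    ((b * (1 - s ^+ 2) + 2 * s * a) / N - q) ^+ 2) = 4 * g by lra.
  have -> : (a - p) ^+ 2 + (b - q) ^+ 2 =
      (a ^+ 2 + b ^+ 2) + p ^+ 2 + q ^+ 2 - 2 * h by rewrite /h; ring.
  have -> : ((a * (1 - s ^+ 2) - 2 * s * b) / N - p) ^+ 2 +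
      ((b * (1 - s ^+ 2) + 2 * s * a) / N - q) ^+ 2 =
      (a ^+ 2 + b ^+ 2) + p ^+ 2 + q ^+ 2 - 2 * (h * (1 - s ^+ 2) + 2 * s * k) / N.
    by rewrite /h /k /N; field; exact: N0'.
  by rewrite /g /N; field; exact: N0'.
Qed.

(** * Roots of a polynomial along a level curve, and critical points *)

Lemma level_closed (R : realType) (p : {poly Cplx R}) (A : R) :
  closed [set z | cmod p.[z] = A].
Proof.
apply: (@preimage_closed _ _ (fun z => cmod p.[z]) [set A]); last exact: closed_eq.
by move=> z _; exact: horner_cmod_continuous.
Qed.

(** Take [z] on the compact level set with [f z] closest to [w]. If [f z != w], some [x] on the
    circle is closer to [w], and openness of [p] makes [x] a value of [f] too. *)
Lemma level_root_surj (R : realType) (p : {poly Cplx R}) (d : nat) (A : R)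
    (f : Cplx R -> Cplx R) (z0 w : Cplx R) :
  (1 < size p)%N -> (0 < d)%N -> 0 < A ->
  continuous_on [set z | cmod p.[z] = A] f ->
  (forall z, cmod p.[z] = A -> f z ^+ d = p.[z]) ->
  cmod p.[z0] = A -> cmod w ^+ d = A ->
  exists2 z, cmod p.[z] = A & f z = w.
Proof.
move=> p1 d0 A0 fc fp Az0 wA; set L := [set z | _] in fc.
have [B hB] := horner_preim_bounded A p1.
have Lcomp : compact L.
  apply: (@compact_closed_bounded R L B); first exact: level_closed.
  by move=> z Lz; apply: hB; rewrite Lz.
have gc : {within L, continuous (fun z => cmod (f z - w))}.
  apply/subspace_continuousP => z Lz.
  apply: (@cvg_comp _ _ _ (fun z => f z - w) (@cmod R) _ (nbhs (f z - w))).
    apply: (@cvgB _ _ _ (within L (nbhs z)) _ f (cst w)); [exact: fc|exact: cvg_cst].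
  exact: cmod_continuous.
have [|z /set_mem Lz zmin] := compact_EVT_min _ Lcomp gc; first by exists z0.
have [fzw|fzw] := eqVneq (f z) w; first by exists z.
have Wd : cmod (f z) ^+ d = A by rewrite -cmodX fp // Lz.
have W0 : 0 < cmod (f z).
  rewrite lt_def cmod_ge0 andbT; apply: contraTneq A0 => W0.
  by rewrite -Wd W0 expr0n gtn_eqF // ltxx.
have Ww : cmod (f z) = cmod w.
  by apply/eqP; rewrite -(eqrXn2 d0) ?cmod_ge0 // Wd wA.
have [s s0 hs] := @expX_expand_near1 R d d0.
(* Radii chosen backwards: [x] within [e3] of [f z] has [x ^+ d] within [e2] of [p.[z]], so it is
   [p.[y]] with [y] within [e1] of [z], and then [f y] is close to [f z]. *)
have [e1 e10 he1] :=
  (iffLR (continuous_on_cmodP L f)) fc z (s * cmod (f z)) Lz (mulr_gt0 s0 W0).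
have [e2 e20 he2] := horner_open z p1 e10.
have : nbhs (f z) [set x | cmod ('X^d.[x] - 'X^d.[f z]) < e2].
  by have := @horner_continuous R 'X^d (f z) _ (cmod_near _ e20).
move=> /nbhs_cmodP[e3 e30 he3].
have [|x [xW xe xw]] := @circle_step R (f z) w (Order.min (s * cmod (f z)) e3) Ww fzw.
  by rewrite lt_min mulr_gt0.
move: xe; rewrite lt_min => /andP[xs x3].
have [|y yz py] := he2 (x ^+ d).
  by have /= := he3 x x3; rewrite !hornerXn fp.
have Ly : L y by rewrite /L /= py cmodX xW.
have near1 v : cmod (v - f z) < s * cmod (f z) -> cmod (v / f z - 1) <= s.
  move=> h; rewrite -[1](@divff _ (f z)) -?cmod_gt0 // -mulrBl cmodM cmodV.
  by rewrite ler_pdivrMr // ltW.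
(* Both are [d]-th roots of [p.[y]]. Divided by [f z] they are near 1, where the power map is
   injective. *)
have fyx : f y = x.
  have := hs _ _ (near1 _ (he1 y Ly yz)) (near1 _ xs).
  rewrite !expr_div_n fp // py subrr cmod0 mulr0 => h.
  have /eqP : cmod (f y / f z - x / f z) = 0 by apply/eqP; rewrite eq_le h cmod_ge0.
  by rewrite cmod_eq0 -mulrBl mulf_eq0 invr_eq0 -[f z == 0]negbK -cmod_gt0 W0 orbF
    subr_eq0 => /eqP.
by have := zmin y (mem_set Ly); rewrite fyx leNgt xw.
Qed.

(** Each of the [d] distinct [d]-th roots of [v = p.[z0]] is some [f z], and then [p.[z] = v]. So
    [p - v%:P] has [d] distinct roots and only simple ones, [z0] among them. *)
Lemma horner_level_simple (R : realType) (p : {poly Cplx R})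
    (f : Cplx R -> Cplx R) (z0 : Cplx R) :
  p \is monic -> (1 < size p)%N -> p.[z0] != 0 ->
  continuous_on [set z | cmod p.[z] = cmod p.[z0]] f ->
  (forall z, cmod p.[z] = cmod p.[z0] -> f z ^+ (size p).-1 = p.[z]) ->
  p^`().[z0] != 0.
Proof.
move=> pm p1 pz0 fc fp; set d := (size p).-1 in fp.
have d0 : (0 < d)%N by rewrite /d -ltnS prednK // ltnW.
set v := p.[z0] in pz0 fc fp *.
pose q : {poly Cplx R} := 'X^d - v%:P.
have [s sE] := closed_field_poly_normal q.
have vX : (size (- v%:P) < size ('X^d : {poly Cplx R}))%N.
  by rewrite size_polyN size_polyXn (leq_ltn_trans (size_polyC_leq1 _)).
have qm : lead_coef q = 1 by rewrite lead_coefDl // lead_coefXn.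
rewrite qm scale1r in sE.
have sz : size s = d.
  have := congr1 (fun q : {poly Cplx R} => size q) sE.
  by rewrite size_prod_XsubC size_polyDl // size_polyXn => -[].
have sq r : r \in s -> r ^+ d = v.
  rewrite -root_prod_XsubC -sE => /rootP; rewrite !hornerE => /eqP.
  by rewrite subr_eq0 => /eqP.
(* ['X^d - v%:P] is separable: its derivative vanishes at most at 0, where its own value is
   [- v != 0]. *)
have us : uniq s.
  rewrite -separable_prod_XsubC -sE separable_poly.unlock.
  rewrite /q derivB derivC subr0 derivXn -scaler_nat coprimepZr ?pnatr_eq0 -?lt0n //.
  apply: coprimep_expr; rewrite coprimepX /root !hornerE expr0n gtn_eqF //.
  by rewrite sub0r oppr_eq0.
have /choice[h hh] : forall r, exists z, r \in s -> p.[z] = v /\ f z = r.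
  move=> r; have [rs|_] := boolP (r \in s); last by exists 0.
  have [||z Lz fz] := @level_root_surj R p d (cmod v) f z0 r p1 d0 _ fc fp erefl.
  - by rewrite cmod_gt0.
  - by rewrite -cmodX sq.
  by exists z => _; split => //; rewrite -(fp z Lz) fz sq.
have pE : p - v%:P = \prod_(z <- [seq h r | r <- s]) ('X - z%:P).
  have vp : (size (- v%:P) < size p)%N.
    by rewrite size_polyN (leq_ltn_trans (size_polyC_leq1 _)).
  have -> := @all_roots_prod_XsubC _ (p - v%:P) [seq h r | r <- s].
  - by rewrite lead_coefDl // (monicP pm) scale1r.
  - by rewrite size_polyDl // size_map sz /d prednK // ltnW.
  - apply/allP => _ /mapP[r rs ->]; apply/rootP; rewrite !hornerE.
    by have [-> _] := hh r rs; rewrite subrr.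
  - rewrite uniq_rootsE map_inj_in_uniq // => r r' rs r's e.
    by have [_ <-] := hh r rs; rewrite e; have [_ ->] := hh r' r's.
have : separable_poly (p - v%:P).
  rewrite pE separable_prod_XsubC map_inj_in_uniq // => r r' rs r's e.
  by have [_ <-] := hh r rs; rewrite e; have [_ ->] := hh r' r's.
rewrite separable_poly.unlock derivB derivC subr0 => /coprimep_root; apply.
by apply/rootP; rewrite !hornerE subrr.
Qed.

(** Each root is exchanged for the centre [k] of its disc, then for [b] through [K]. Multiplying the
    resulting roots yields a continuous [d]-th root of the monic multiple of [q] on the level
    set. *)
Lemma horner_critical_nonzero (R : realType) (q : {poly Cplx R}) (K : set (Cplx R))
    (b z0 : Cplx R) :
  (1 < size q)%N -> q.[z0] != 0 -> connected K -> K b ->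
  (forall k, K k -> cmod q.[k] <> cmod q.[z0]) ->
  (forall r, root q r -> exists k e, [/\ K k, cmod (r - k) < e &
    forall w, cmod (w - k) < e -> cmod q.[w] <> cmod q.[z0]]) ->
  q^`().[z0] != 0.
Proof.
move=> q1 qz0 Kc Kb KL rK.
have a0 : lead_coef q != 0 by rewrite lead_coef_eq0 -size_poly_gt0 ltnW.
pose p := (lead_coef q)^-1 *: q.
have pm : p \is monic by apply/monicP; rewrite lead_coefZ mulVf.
have szp : size p = size q by rewrite size_scale // invr_eq0.
have hp z : p.[z] = (lead_coef q)^-1 * q.[z] by rewrite hornerZ.
have [s sE] := closed_field_poly_normal p; rewrite (monicP pm) scale1r in sE.
have sz : size s = (size p).-1 by rewrite sE size_prod_XsubC.
pose d := (size p).-1; pose L := [set z | cmod p.[z] = cmod p.[z0]].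
have d0 : (0 < d)%N by rewrite /d szp -ltnS prednK // ltnW.
have LE z : L z -> cmod q.[z] = cmod q.[z0].
  rewrite /L /= !hp !cmodM => /mulfI; apply.
  by rewrite gt_eqF // cmod_gt0 invr_eq0.
have Lc : closed L by exact: level_closed.
have KnL k : K k -> ~ L k by move=> /KL h /LE.
have ratio r : r \in s -> ratio_root d L r b.
  rewrite -root_prod_XsubC -sE => /rootP; rewrite hp => /eqP.
  rewrite mulf_eq0 invr_eq0 (negPf a0) /= => qr.
  have [k [e [Kk re ke]]] := rK r qr.
  apply: (@ratio_root_trans R d L k); first exact: KnL.
    by apply: (@ratio_root_ball R d L r k e) => // w /ke h /LE.
  apply: (@ratio_root_connected R d L K) => //.
  by apply/seteqP; split => // x [/KnL].
have /choice[g hg] : forall r, exists g, continuous_on L g /\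
    (r \in s -> forall z, L z -> g z ^+ d = (z - r) / (z - b)).
  move=> r; have [/ratio[g gc gr]|_] := boolP (r \in s); first by exists g.
  by exists (cst 1); split => // z _; exact: cvg_cst.
(* As [s] lists [d] roots with multiplicity, the factor [(z - b) ^+ d] cancels all the denominators
   in [f z ^+ d]. *)
pose f z := (z - b) * \prod_(r <- s) g r z.
suff : p^`().[z0] != 0 by rewrite derivZ hornerZ; apply: contraNneq => ->; rewrite mulr0.
apply: (@horner_level_simple R p f z0) => //.
- by rewrite szp.
- by rewrite hp mulf_neq0 // invr_eq0.
- apply: (@continuous_onM R L (fun z => z - b) (fun z => \prod_(r <- s) g r z)).
    exact: continuous_on_subC.
  by apply: continuous_on_prod => r; have [] := hg r.
- move=> z Lz; rewrite -/d exprMn -prodrXl.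
  have -> : \prod_(r <- s) g r z ^+ d = \prod_(r <- s) ((z - r) / (z - b)).
    by apply: eq_big_seq => r rs; have [_ /(_ rs z Lz)] := hg r.
  have zb : z - b != 0 by rewrite subr_eq0; apply: contra_not_neq (KnL b Kb) => <-.
  rewrite big_split /= big_const_seq count_predT iter_mulr_1 sz -/d exprVn mulrCA.
  rewrite mulfV ?expf_neq0 // mulr1 sE horner_prod.
  by apply: eq_bigr => r _; rewrite !hornerE.
Qed.

(** * Nested compact sets, and growth of the moduli of an orbit *)

(** Each point has a neighbourhood in which, for all large [n], [C n] stays inside [O]: either [O]
    itself, or the complement of some [C m]. Compactness makes [n] uniform. *)
Lemma decreasing_compact_sub (T : topologicalType) (C : nat -> set T) (O : set T) :
  (forall n, closed (C n)) -> compact (C 0%N) ->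
  (forall m n, (m <= n)%N -> C n `<=` C m) -> open O ->
  \bigcap_n C n `<=` O -> exists n, C n `<=` O.
Proof.
move=> Cc C0 Cd Oo CO.
have [|n _ hn] := iffLR (compact_near_coveringP _) C0 nat \oo (fun n x => C n x -> O x) _.
  move=> x _; have [Ox|Ox] := pselect (O x).
    exists (O, setT) => /=; first by split; [exact: open_nbhs_nbhs|exact: filterT].
    by move=> [y n] /= [].
  have [m Cm] : exists m, ~ C m x.
    by apply/existsNP => Cx; apply: Ox; apply: CO => n _.
  exists (~` C m, [set n | (m <= n)%N]) => /=.
    split; last by exists m.
    by apply: open_nbhs_nbhs; split => //; exact: closed_openC.
  by move=> [y n] /= [Cy mn] /(Cd _ _ mn).
by exists n => x Cx; apply: (hn n) => //=; exact: Cd Cx.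
Qed.

(** The triangle inequalities for [f_(n+2) = f_(n+1) f_n + c] with [m = |c|]. The dynamics is
    studied through these real sequences only. *)
Definition fib_moduli (R : realType) (m : R) (x : nat -> R) :=
  forall n, [/\ 0 <= x n, x n.+2 <= x n.+1 * x n + m & x n.+1 * x n - m <= x n.+2].

(** Since [x_(n+1) m - m = x_(n+1) + x_(n+1) (m - 1) - m], two consecutive terms at least [m] force
    a fixed gain, positive because [m > 2]. *)
Lemma fib_moduli_ge (R : realType) (m : R) (x : nat -> R) n :
  2 < m -> fib_moduli m x -> m <= x n -> m <= x n.+1 ->
  x n.+1 + m * (m - 2) <= x n.+2.
Proof.
move=> m2 xm h0 h1; have [_ _ h] := xm n; apply: le_trans h.
have : x n.+1 * m <= x n.+1 * x n by apply: ler_wpM2l => //; lra.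
have : m * (m - 1) <= x n.+1 * (m - 1) by apply: ler_wpM2r => //; lra.
lra.
Qed.

Lemma fib_moduli_escape (R : realType) (m : R) (x : nat -> R) n :
  2 < m -> fib_moduli m x -> m <= x n -> m <= x n.+1 ->
  forall B, exists k0, forall k, (k0 <= k)%N -> B <= x k.
Proof.
move=> m2 xm h0 h1 B.
have e0 : 0 < m * (m - 2) by apply: mulr_gt0; lra.
have H k : [/\ m <= x (n + k)%N, m <= x (n + k).+1 &
    m + k%:R * (m * (m - 2)) <= x (n + k).+1].
  elim: k => [|k [i1 i2 i3]]; first by rewrite addn0 mul0r addr0.
  have := fib_moduli_ge m2 xm i1 i2; rewrite addnS => i4; split => //; first lra.
  by rewrite -natr1; lra.
have [k kB] : exists k : nat, B <= k%:R * (m * (m - 2)).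
  exists (Num.truncn (`|B| / (m * (m - 2)))).+1.
  rewrite -ler_pdivrMr //; apply: le_trans (ltW (truncnS_gt _)).
  by rewrite ler_pM2r ?invr_gt0 // ler_norm.
(* Write [j = (n + i).+1] with [i = (j - n).-1], so that [k <= i]. *)
exists (n + k).+1 => j kj; have [_ _] := H (j - n).-1.
have nj : (n < j)%N by apply: leq_trans kj; rewrite ltnS leq_addr.
rewrite -addnS prednK ?subn_gt0 // subnKC ?(ltnW nj) //.
apply: le_trans; apply: (le_trans kB).
apply: (@le_trans _ _ ((j - n).-1%:R * (m * (m - 2)))); last lra.
apply: ler_wpM2r; first lra.
by rewrite ler_nat -ltnS prednK ?subn_gt0 // ltn_subRL.
Qed.

(* If [B < x n.+2] then [x n.+1] and [x n.+3] are small, so [x n.+1 * x n.+2] is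
   small too, and then [x n] has to be even larger than [x n.+2]. *)
Lemma fib_moduli_bounded (R : realType) (m : R) (x : nat -> R) :
  2 < m -> fib_moduli m x -> (forall n, x n <= m \/ x n.+1 <= m) ->
  forall B, 3 * m <= B -> x 0%N <= B -> x 1%N <= B -> forall n, x n <= B.
Proof.
move=> m2 xm small B mB x0 x1.
suff H n : x n <= B /\ x n.+1 <= B by move=> n; have [] := H n.
elim: n => [//|n [i1 i2]]; split => //.
rewrite leNgt; apply/negP => xB.
have [a0 a2 _] := xm n; have [b0 _ b2] := xm n.+1.
have [c0 _ _] := xm n.+2.
have s1 : x n.+1 <= m by case: (small n.+1) => //; lra.
have s3 : x n.+3 <= m by case: (small n.+2) => //; lra.
have h1 : x n.+2 * x n.+1 <= 2 * m by lra.
have : x n.+1 * x n <= x n.+1 * B by apply: ler_wpM2l.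
have : x n.+1 * B <= x n.+1 * x n.+2 by apply: ler_wpM2l => //; lra.
lra.
Qed.

(** * The iterates as formal polynomials *)

Fixpoint fpoly (R : realType) (p : {poly Cplx R}) (c : Cplx R) (n : nat) :
    {poly Cplx R} :=
  match n with
  | 0 => 'X
  | 1 => p
  | (m.+1 as k).+1 => fpoly p c k * fpoly p c m + c%:P
  end.

Lemma fpolySS (R : realType) (p : {poly Cplx R}) (c : Cplx R) n :
  fpoly p c n.+2 = fpoly p c n.+1 * fpoly p c n + c%:P.
Proof. by []. Qed.

Lemma fseqSS (R : realType) (f : Cplx R -> Cplx R) (c z : Cplx R) n :
  fseq f c n.+2 z = fseq f c n.+1 z * fseq f c n z + c.
Proof. by []. Qed.

Lemma horner_fpoly (R : realType) (p : {poly Cplx R}) (c z : Cplx R) n :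
  (fpoly p c n).[z] = fseq (horner p) c n z.
Proof.
suff [] : (fpoly p c n).[z] = fseq (horner p) c n z /\
  (fpoly p c n.+1).[z] = fseq (horner p) c n.+1 z by [].
elim: n => [|n [h1 h2]]; first by rewrite /= hornerX.
by split=> //; rewrite fpolySS fseqSS hornerD hornerM hornerC h1 h2.
Qed.

Lemma size_fpoly (R : realType) (p : {poly Cplx R}) (c : Cplx R) n :
  (1 < size p)%N -> (1 < size (fpoly p c n))%N.
Proof.
move=> p1; suff [] : (1 < size (fpoly p c n))%N /\ (1 < size (fpoly p c n.+1))%N by [].
elim: n => [|n [h1 h2]]; first by rewrite size_polyX.
split => //; rewrite fpolySS.
have q1 : (1 < size (fpoly p c n.+1 * fpoly p c n)%R)%N.
  rewrite size_mul -?size_poly_gt0 ?(ltnW h1) ?(ltnW h2) //.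
  by case: (size _) h1 => [|[|k]] //; case: (size _) h2 => [|[|l]] // _ _; rewrite !addnS.
by rewrite size_polyDl // (leq_ltn_trans (size_polyC_leq1 _)).
Qed.

Lemma deriv_fpoly0 (R : realType) (p : {poly Cplx R}) (c : Cplx R) n :
  p.[0] = 0 -> p^`().[0] = 0 -> (fpoly p c n.+1)^`().[0] = 0.
Proof.
move=> p0 dp0; suff [] : (fpoly p c n.+1)^`().[0] = 0 /\ (fpoly p c n.+2)^`().[0] = 0 by [].
elim: n => [|n [h1 h2]].
  (* For [f_2] the product rule leaves the term [f_1 f_0'] with [f_0' = 1]; it vanishes because
     [p.[0] = 0]. *)
  by rewrite fpolySS derivD derivM derivC addr0 !hornerE /= p0 dp0 !(mul0r, mulr0, addr0).
split=> //; rewrite fpolySS derivD derivM derivC addr0 hornerD !hornerM h1 h2.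
by rewrite !(mul0r, mulr0, addr0).
Qed.

Lemma fib_moduli_fseq (R : realType) (f : Cplx R -> Cplx R) (c z : Cplx R) :
  fib_moduli (cmod c) (fun n => cmod (fseq f c n z)).
Proof.
move=> n; split; first exact: cmod_ge0.
  by rewrite fseqSS -cmodM; exact: cmodD.
by rewrite fseqSS -cmodM; exact: cmodD_ge.
Qed.

(** * The filled-in Julia set as a decreasing intersection of compact sets *)

Lemma filled_juliaP (R : realType) (f : Cplx R -> Cplx R) (c z : Cplx R) :
  filled_julia f c z <-> exists B, forall n, cmod (fseq f c n z) <= B.
Proof.
rewrite /filled_julia /=; split=> [|[B hB]].
  have ub n : ((cmod (fseq f c n z))%:E <=
      ereal_sup (range (fun n => (cmod (fseq f c n z))%:E)))%E.
    by apply: ereal_sup_ubound; exists n.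
  case: (ereal_sup _) ub => [B ub _|//|ub _]; last by have := ub 0%N.
  by exists B => n; have := ub n; rewrite lee_fin.
apply: (@le_lt_trans _ _ B%:E); last exact: ltry.
by apply: ge_ereal_sup => _ [n _ <-]; rewrite lee_fin.
Qed.

(** The complement is the escape condition: two consecutive moduli above [|c|]. *)
Definition trap (R : realType) (f : Cplx R -> Cplx R) (c : Cplx R) (n : nat) :
    set (Cplx R) :=
  [set z | cmod (fseq f c n z) <= cmod c] `|` [set z | cmod (fseq f c n.+1 z) <= cmod c].

Lemma trap_decreasing (R : realType) (f : Cplx R -> Cplx R) (c : Cplx R) m n :
  2 < cmod c -> (m <= n)%N -> trap f c n `<=` trap f c m.
Proof.
move=> c2 /subnK <-; elim: (n - m)%N => [//|k IH]; apply: subset_trans IH.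
rewrite addSn => z; apply: contraPP; rewrite /trap /= !not_orP.
move: (k + m)%N => j [/negP + /negP +]; rewrite -!ltNge => h0 h1.
split; apply/negP; rewrite -ltNge //.
have := fib_moduli_ge c2 (fib_moduli_fseq f c z) (ltW h0) (ltW h1).
have : 0 < cmod c * (cmod c - 2) by apply: mulr_gt0; lra.
lra.
Qed.

Lemma filled_julia_trap (R : realType) (f : Cplx R -> Cplx R) (c : Cplx R) :
  2 < cmod c -> filled_julia f c = \bigcap_n trap f c n.
Proof.
move=> c2; apply/seteqP; split => z.
  move=> /filled_juliaP[B hB] n _; apply: contrapT; rewrite /trap /= not_orP.
  move=> [/negP + /negP +]; rewrite -!ltNge => h0 h1.
  have [k /(_ k (leqnn k))] :=
    fib_moduli_escape c2 (fib_moduli_fseq f c z) (ltW h0) (ltW h1) (B + 1).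
  by have := hB k; lra.
move=> Cz; apply/filled_juliaP.
pose B := 3 * cmod c + cmod (fseq f c 0 z) + cmod (fseq f c 1 z).
have := cmod_ge0 (fseq f c 0 z); have := cmod_ge0 (fseq f c 1 z) => g1 g0.
exists B; apply: (fib_moduli_bounded c2 (fib_moduli_fseq f c z)); rewrite /B; try lra.
by move=> n; have [] := Cz n I; [left|right].
Qed.

Lemma trap_closed (R : realType) (p : {poly Cplx R}) (c : Cplx R) n :
  closed (trap (horner p) c n).
Proof.
have H k : closed [set z | cmod (fseq (horner p) c k z) <= cmod c].
  have -> : [set z | cmod (fseq (horner p) c k z) <= cmod c] =
      (fun z => cmod (fpoly p c k).[z]) @^-1` [set x | x <= cmod c].
    by apply/seteqP; split => z /=; rewrite horner_fpoly.
  apply: preimage_closed; last exact: closed_le.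
  by move=> z _; exact: horner_cmod_continuous.
exact: closedU.
Qed.

Lemma trap_compact (R : realType) (p : {poly Cplx R}) (c : Cplx R) :
  (1 < size p)%N -> compact (trap (horner p) c 0).
Proof.
move=> p1; have [B hB] := horner_preim_bounded (cmod c) p1.
apply: (@compact_closed_bounded R _ (`|B| + cmod c)); first exact: trap_closed.
have := cmod_ge0 c; have := normr_ge0 B; have := ler_norm B.
by move=> b1 b2 b3 z [|/hB] /=; lra.
Qed.

(** Membership in [trap] of index 0 bounds [|z|] and [|p(z)|] uniformly, and the orbit bound depends
    only on these and on [|c|]. *)
Lemma filled_julia_unif_bounded (R : realType) (p : {poly Cplx R}) (c : Cplx R) :
  (1 < size p)%N -> 2 < cmod c ->
  exists B, forall z n, filled_julia (horner p) c z -> cmod (fseq (horner p) c n z) <= B.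
Proof.
move=> p1 c2; have [B hB] := horner_preim_bounded (cmod c) p1.
have [M hM] := horner_disk_bounded p (`|B| + cmod c).
have c0 := cmod_ge0 c.
exists (3 * cmod c + `|B| + `|M|) => z n; rewrite filled_julia_trap // => Cz.
have b0 := normr_ge0 B; have m0 := normr_ge0 M; have b1 := ler_norm B; have m1 := ler_norm M.
have zB : cmod z <= `|B| + cmod c by case: (Cz 0%N I) => /= [|/hB]; lra.
apply: (fib_moduli_bounded c2 (fib_moduli_fseq _ c z)); rewrite /=; try lra.
  by move=> k; have [] := Cz k I; [left|right].
by have := hM z zB; lra.
Qed.

Lemma fseq_orbit0_escape (R : realType) (p : {poly Cplx R}) (c : Cplx R) (B : R) :
  p.[0] = 0 -> 2 < cmod c ->
  exists k0, forall k, (k0 <= k)%N -> B <= cmod (fseq (horner p) c k 0).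
Proof.
move=> p0 c2; apply: (fib_moduli_escape (n := 2) c2 (fib_moduli_fseq _ c 0)).
  by rewrite /= p0 mul0r add0r.
by rewrite /= p0 mulr0 add0r.
Qed.

(** The margin reproduces itself: [(x_(j+1) + 2m)(x_j + 2m)] exceeds [x_(j+1) x_j] by at least
    [4m^2 >= 4m], which pays for an error [m] on each side and the new margin [2m]. *)
Lemma fib_moduli_compare (R : realType) (m : R) (x y : nat -> R) N :
  1 <= m -> fib_moduli m x -> fib_moduli m y ->
  x N + 2 * m <= y N -> x N.+1 + 2 * m <= y N.+1 ->
  forall n, (N <= n)%N -> x n + 2 * m <= y n.
Proof.
move=> m1 xm ym h0 h1 n /subnK <-; have m0 : 0 < m by lra.
suff [] : x (n - N + N)%N + 2 * m <= y (n - N + N)%N /\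
  x (n - N + N).+1 + 2 * m <= y (n - N + N).+1 by [].
elim: (n - N)%N => [//|k [i0 i1]]; split => //; rewrite !addSn.
move: (k + N)%N i0 i1 => j i0 i1.
have [a0 a1 _] := xm j; have [b0 _ b1] := ym j; have [c0 _ _] := xm j.+1.
have h : (x j.+1 + 2 * m) * (x j + 2 * m) <= y j.+1 * y j by apply: ler_pM => //; lra.
have := mulr_ge0 (ltW m0) a0; have := mulr_ge0 (ltW m0) c0.
have : 0 <= m * (m - 1) by apply: mulr_ge0; lra.
lra.
Qed.

(** * The escaping critical point 0 against connectedness *)

Theorem proposition4p1 (R : realType) (p : {poly Cplx R})
    (p_nonconst : (1 < size p)%N) (p0 : p.[0] = 0) (dp0 : p^`().[0] = 0)
    (c : Cplx R) (c_gt2 : 2 < cmod c) :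
  ~ connected (filled_julia (horner p) c).
Proof.
set K := filled_julia _ _; move=> Kc.
pose F n z := cmod (fseq (horner p) c n z).
have [B hB] := filled_julia_unif_bounded p_nonconst c_gt2.
(* Orbits in [K] are bounded by [B]; the 1 leaves room for the open set [O], and [2 * cmod c] is the
   margin of the comparison lemma. *)
have [N hN] := fseq_orbit0_escape (B + 1 + 2 * cmod c) p0 c_gt2.
pose O := [set z | F N z < B + 1] `&` [set z | F N.+1 z < B + 1].
have Olt z n : O z -> (N <= n)%N -> F n z < F n 0.
  move=> [zN zN1] Nn.
  have := fib_moduli_compare _ (fib_moduli_fseq (horner p) c z)
    (fib_moduli_fseq (horner p) c 0) _ _ Nn.
  rewrite -/(F n z) -/(F n 0) => h.
  suff : F n z + 2 * cmod c <= F n 0 by lra.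
  apply: h; first lra.
    by have := hN N (leqnn N); move: zN; rewrite /F /=; lra.
  by have := hN N.+1 (leqnSn N); move: zN1; rewrite /F /=; lra.
have Oo : open O.
  have H k : open [set z | F k z < B + 1].
    have -> : [set z | F k z < B + 1] =
        (fun z => cmod (fpoly p c k).[z]) @^-1` [set x | x < B + 1].
      by apply/seteqP; split => z /=; rewrite horner_fpoly.
    by apply: open_comp; [move=> z _; exact: horner_cmod_continuous | exact: open_lt].
  exact: openI.
have KO : K `<=` O by move=> z Kz; split; apply: (le_lt_trans (hB z _ Kz)); lra.
(* Discs centred in [K] rather than [O] itself: each root must be joined to a point of [K] without
   meeting the level set. *)
pose U := [set z | exists k e, [/\ K k, cmod (z - k) < e &
  forall w, cmod (w - k) < e -> O w]].
have Uo : open U.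
  rewrite openE => z [k [e [Kk ze ke]]]; apply/nbhs_cmodP.
  exists (e - cmod (z - k)) => [|w wz]; first lra.
  by exists k, e; split => //; have := cmod_trans z w k; lra.
have KU : \bigcap_n trap (horner p) c n `<=` U.
  rewrite -filled_julia_trap // => k Kk.
  have /nbhs_cmodP[e e0 he] : nbhs k O by apply: open_nbhs_nbhs; split => //; exact: KO.
  by exists k, e; split; rewrite // subrr cmod0.
have [n0 hn0] := decreasing_compact_sub (@trap_closed R p c) (@trap_compact R p c p_nonconst)
  (fun m n => @trap_decreasing R (horner p) c m n c_gt2) Uo KU.
(* Large enough for both the inclusion of the trap in [U] and the comparison with the orbit of 0; a
   successor, so that 0 is a critical point of [q]. *)
pose n := (maxn n0 N).+1; pose q := fpoly p c n.
have Nn : (N <= n)%N by rewrite /n ltnW // ltnS leq_maxr.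
have qE z : cmod q.[z] = F n z by rewrite /q horner_fpoly.
have rU r : root q r -> U r.
  move=> /rootP qr; apply: hn0; apply: (@trap_decreasing _ _ _ _ n c_gt2).
    by rewrite /n ltnW // ltnS leq_maxl.
  by left; rewrite /= -/(F n r) -qE qr cmod0 cmod_ge0.
have q1 : (1 < size q)%N by exact: size_fpoly.
(* The existence of a root of [q] also shows that [K] is nonempty. *)
have [r /rU [b [_ [Kb _ _]]]] : exists r, root q r.
  by apply/closed_rootP; rewrite gtn_eqF.
have : q^`().[0] != 0.
  apply: (@horner_critical_nonzero R q K b 0) => //.
  - rewrite -cmod_gt0 qE; apply: le_lt_trans (Olt b n (KO _ Kb) Nn); exact: cmod_ge0.
  - by move=> k Kk; rewrite !qE => h; have := Olt k n (KO _ Kk) Nn; rewrite h ltxx.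
  - move=> s /rU [k [e [Kk se ke]]]; exists k, e; split => // w /ke Ow.
    by rewrite !qE => h; have := Olt w n Ow Nn; rewrite h ltxx.
by rewrite /q /n deriv_fpoly0 // eqxx.
Qed.
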